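(* Let $N\in(1,\infty)$ and let $(I,|\cdot|,h\,\mathcal L^1)$ be a one-dimensional metric measure space satisfying $\mathsf{MCP}(0,N)$, where $I\subset\mathbb R$ is an open interval, $0\in I$, $\sup I=+\infty$, and $h>0$ in $I$. Then the function $$(0,\infty)\ni R\longmapsto\frac{h(R)}{NR^{N-1}}$$ is non-increasing. In particular, the limit $$\theta:=\lim_{R\to+\infty}\frac{h(R)}{NR^{N-1}}$$ exists. Moreover, $$I\subset\left(-\left(\frac{h(0)}{N\theta}\right)^{\frac1{N-1}},+\infty\right),$$ with the convention that the left endpoint equals $-\infty$ if $\theta=0$.
   Context: $\mathcal L^1$ is Lebesgue measure. For an open interval $I\subset\mathbb R$ with $a=\inf I$, $b=\sup I$, the space $(I,|\cdot|,h\,\mathcal L^1)$ with $h:I\to(0,\infty)$ continuous satisfies $\mathsf{MCP}(0,N)$ if $$\left(\frac{b-x_1}{b-x_0}\right)^{N-1}\le\frac{h(x_1)}{h(x_0)}\le\left(\frac{x_1-a}{x_0-a}\right)^{N-1}\qquad\text{for all }a<x_0<x_1<b,$$ where a ratio involving an infinite endpoint is read as $1$. Equivalently, $h((1-t)x_0+tx_1)\ge(1-t)^{N-1}h(x_0)$ for all $x_0,x_1\in I$ and $t\in[0,1]$. *)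

(* Defs.v *)
From mathcomp Require Export all_boot all_order all_algebra.
From mathcomp Require Export all_classical all_reals all_analysis.

Set Implicit Arguments.
Unset Strict Implicit.
Unset Printing Implicit Defensive.

Import Order.TTheory GRing.Theory Num.Theory.
Import numFieldNormedType.Exports.

Local Open Scope classical_set_scope.
Local Open Scope ring_scope.

Definition open_interval (R : realType) (I : set R) : Prop :=
  [/\ open I, is_interval I & I !=set0].

Definition einf (R : realType) (I : set R) : \bar R :=
  ereal_inf [set x%:E | x in I].

Definition esup (R : realType) (I : set R) : \bar R :=
  ereal_sup [set x%:E | x in I].

(* (b - x1) / (b - x0) and (x1 - a) / (x0 - a), read as 1 when the endpoint
   is infinite. *)
Definition sup_ratio (R : realType) (b : \bar R) (x0 x1 : R) : R :=
  if b is r%:E then (r - x1) / (r - x0) else 1.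

Definition inf_ratio (R : realType) (a : \bar R) (x0 x1 : R) : R :=
  if a is r%:E then (x1 - r) / (x0 - r) else 1.

(* MCP(0, N) for (I, |.|, h L^1) with I an open interval; the density h is a
   total function of which only the values on I matter. *)
Definition MCP0 (R : realType) (N : R) (I : set R) (h : R -> R) : Prop :=
  let a := einf I in let b := esup I in
  forall x0 x1 : R, (a < x0%:E)%E -> x0 < x1 -> (x1%:E < b)%E ->
    sup_ratio b x0 x1 `^ (N - 1) <= h x1 / h x0
      <= inf_ratio a x0 x1 `^ (N - 1).

Definition density_ratio (R : realType) (N : R) (h : R -> R) (r : R) : R :=
  h r / (N * r `^ (N - 1)).

Definition left_bound (R : realType) (N h0 theta : R) : \bar R :=
  if theta == 0 then -oo%E
  else (- (h0 / (N * theta)) `^ (1 / (N - 1)))%:E.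

(* Main.v *)
Require Import Defs.
From mathcomp Require Import all_boot all_order all_algebra.
From mathcomp Require Import all_classical all_reals all_analysis.
From mathcomp Require Import lra.

Set Implicit Arguments.
Unset Strict Implicit.
Unset Printing Implicit Defensive.

Import Order.TTheory GRing.Theory Num.Theory.
Import numFieldNormedType.Exports.

Local Open Scope classical_set_scope.
Local Open Scope ring_scope.

(** The MCP upper bound says that h grows from x0 to x1 at most like the density
    of the model half-line (a, +oo), whose vertex is the left endpoint a of I.
    Moving the vertex to the right, from a to any point c < x0, only increases
    the ratio (x1 - c) / (x0 - c), so every c >= a may serve as a vertex
    ([MCP0_growth_le]). This one estimate, which no longer distinguishes a
    finite a from an infinite one, gives everything.

    With c = 0 it says that h r / r ^ (N - 1) is non-increasing; being
    positive, it has a limit theta, which lies below all its values.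

    For the position of I, only a point x < 0 of I and theta > 0 need an
    argument. As I is open, it contains some y < x; with vertex c = y and
    x0 = 0 the estimate bounds h r / (N r ^ (N - 1)), hence theta, from above
    for every r > 0, and solving for h 0 / (N theta) gives ([MCP0_vertex_le])
      r (- y) / (r - y) <= (h 0 / (N theta)) ^ (1 / (N - 1)).
    The left side tends to - y > - x as r grows, hence exceeds - x for a
    suitable explicit r; no strictness is lost in a limit. *)

Lemma nonincreasing_cvgr_pinfty (R : realType) (f : R -> R) (a b : R) :
  {in `]a, +oo[ &, {homo f : r s /~ r <= s}} ->
  (forall r, a < r -> b <= f r) ->
  cvg (f r @[r --> +oo]).
Proof.
move=> f_ni b_le_f.
(* The monotone convergence theorem wants monotonicity on the whole line:
   freeze f at its value at a + 1 to the left of that point. *)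
pose g r := - f (Num.max (a + 1) r).
have max_gt r : a < Num.max (a + 1) r by rewrite lt_max ltrDl ltr01.
have g_nd : {homo g : r s / r <= s}.
  move=> r s rs; rewrite lerN2; apply: f_ni.
  - by rewrite in_itv /= andbT max_gt.
  - by rewrite in_itv /= andbT max_gt.
  - by rewrite ge_max !le_max lexx rs orbT.
have g_ub : has_ubound (range g).
  by exists (- b) => _ [r _ <-]; rewrite lerN2 b_le_f.
have /cvgN g_cvg := nondecreasing_cvgr g_nd g_ub.
apply/cvg_ex; exists (- sup (range g)); apply: cvg_trans g_cvg.
apply: near_eq_cvg; near=> r.
rewrite /g /= opprK (_ : Num.max _ _ = r) //.
by apply/max_idPr; near: r; exact: nbhs_pinfty_ge (num_real _).
Unshelve. all: by end_near. Qed.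

Lemma nonincreasing_lim_pinfty_le (R : realType) (f : R -> R) (a r : R) :
  {in `]a, +oo[ &, {homo f : r s /~ r <= s}} ->
  cvg (f r @[r --> +oo]) -> a < r ->
  lim (f r @[r --> +oo]) <= f r.
Proof.
move=> f_ni f_cvg ar; apply: limr_le => //; near=> s.
have rs : r <= s by near: s; exact: nbhs_pinfty_ge (num_real _).
by apply: f_ni => //; rewrite in_itv /= andbT // (lt_le_trans ar).
Unshelve. all: by end_near. Qed.

Lemma powR_div (R : realType) (x y p : R) :
  0 <= x -> 0 <= y -> (x / y) `^ p = x `^ p / y `^ p.
Proof.
move=> x0 y0; rewrite powRM ?invr_ge0 //.
by rewrite -(powR_inv1 y0) powRAC powR_inv1 ?powR_ge0.
Qed.

Lemma esup_pinfty_mem (R : realType) (I : set R) (x r : R) :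
  is_interval I -> esup I = +oo%E -> I x -> x <= r -> I r.
Proof.
move=> I_itv supI Ix xr; have : (r%:E < esup I)%E by rewrite supI ltry.
move=> /ereal_sup_gt [_ [y Iy <-]]; rewrite lte_fin => /ltW ry.
by apply: (I_itv x y) => //; rewrite xr ry.
Qed.

Lemma einf_le (R : realType) (I : set R) (x : R) : I x -> (einf I <= x%:E)%E.
Proof. by move=> Ix; apply: ereal_inf_lbound; exists x. Qed.

Lemma open_lt_mem (R : realType) (I : set R) (x : R) :
  open I -> I x -> exists2 y, y < x & I y.
Proof.
move=> I_open Ix; near (x^'-) => y; exists y; near: y.
  exact: nbhs_left_lt.
by apply: cvg_within; exact: open_nbhs_nbhs.
Unshelve. all: by end_near. Qed.

(** Writing (x1 - c) / (x0 - c) as 1 + (x1 - x0) / (x0 - c) shows that it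
    increases with c < x0, from the value 1 approached as c goes to -oo. This is
    what makes the infinite endpoint a limiting case of the finite ones. *)
Lemma inf_ratio_le (R : realType) (a : \bar R) (c x0 x1 : R) :
  (a <= c%:E)%E -> c < x0 -> x0 < x1 ->
  0 <= inf_ratio a x0 x1 <= (x1 - c) / (x0 - c).
Proof.
case: a => [a||] //= ac cx0 x01; last first.
  by rewrite ler01 ler_pdivlMr ?subr_gt0 // mul1r lerB // ltW.
rewrite lee_fin in ac.
have x0a : 0 < x0 - a by lra.
have x0c : 0 < x0 - c by lra.
apply/andP; split; first by rewrite divr_ge0 ?(ltW x0a) //; lra.
rewrite ler_pdivrMr // mulrAC ler_pdivlMr // -subr_ge0.
have : 0 <= (x1 - x0) * (c - a) by rewrite mulr_ge0 ?subr_ge0 // ltW.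
lra.
Qed.

(** The freedom in c is the point: a real c always exists even if einf I is
    infinite, so later arguments need no case distinction on the left
    endpoint. *)
Lemma MCP0_growth_le (R : realType) (N : R) (I : set R) (h : R -> R)
    (c x0 x1 : R) :
  1 <= N -> MCP0 N I h -> esup I = +oo%E -> 0 < h x0 ->
  (einf I <= c%:E)%E -> c < x0 -> x0 <= x1 ->
  h x1 <= h x0 * ((x1 - c) / (x0 - c)) `^ (N - 1).
Proof.
move=> N1 mcp supI h0 ac cx0; rewrite le_eqVlt => /predU1P[<-|x01].
  by rewrite divff ?subr_eq0 ?gt_eqF // powR1 mulr1.
have ax0 : (einf I < x0%:E)%E by rewrite (le_lt_trans ac) // lte_fin.
have x1b : (x1%:E < esup I)%E by rewrite supI ltry.
have /andP[_] := mcp x0 x1 ax0 x01 x1b.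
have /andP[q0 qle] := inf_ratio_le ac cx0 x01.
rewrite ler_pdivrMr // mulrC => /le_trans; apply.
rewrite ler_pM2l //; apply: ge0_ler_powR; rewrite ?nnegrE ?subr_ge0 //.
exact: le_trans qle.
Qed.

Lemma density_ratio_nonincreasing (R : realType) (N : R) (I : set R)
    (h : R -> R) :
  1 <= N -> MCP0 N I h -> esup I = +oo%E -> (einf I <= 0%:E)%E ->
  (forall r, 0 < r -> 0 < h r) ->
  {in `]0, +oo[ &, {homo density_ratio N h : r s /~ r <= s}}.
Proof.
move=> N1 mcp supI a0 h_gt0 s r; rewrite !in_itv /= !andbT => s0 r0 rs.
have N0 : 0 < N by exact: lt_le_trans N1.
have := MCP0_growth_le N1 mcp supI (h_gt0 _ r0) a0 r0 rs.
rewrite !subr0 powR_div ?(ltW s0) ?(ltW r0) // => hs.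
have ps : 0 < s `^ (N - 1) by exact: powR_gt0.
rewrite /density_ratio !invfM !mulrA !(mulrAC _ N^-1) ler_pM2r ?invr_gt0 //.
by rewrite ler_pdivrMr // -mulrA (mulrC _ (s `^ _)).
Qed.

(** The growth estimate from x0 = 0 to r, solved for the quantity whose opposite
    bounds I on the left. Keeping r finite, rather than letting it go to +oo to
    get - c on the left-hand side, spares computing the limit of the model
    density. *)
Lemma MCP0_vertex_le (R : realType) (N : R) (I : set R) (h : R -> R)
    (c r theta : R) :
  1 < N -> MCP0 N I h -> esup I = +oo%E -> 0 < h 0 ->
  (einf I <= c%:E)%E -> c < 0 -> 0 < r ->
  0 < theta -> theta <= density_ratio N h r ->
  r * - c / (r - c) <= (h 0 / (N * theta)) `^ (1 / (N - 1)).
Proof.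
move=> N1 mcp supI h0 ac c0 r0 th0 th_le.
have N0 : 0 < N by lra.
have p0 : 0 < N - 1 by lra.
have rc0 : 0 < r - c by lra.
have nc0 : 0 < - c by lra.
have pr : 0 < r `^ (N - 1) by exact: powR_gt0.
have pc : 0 < (- c) `^ (N - 1) by exact: powR_gt0.
have prc : 0 < (r - c) `^ (N - 1) by exact: powR_gt0.
have hr := MCP0_growth_le (ltW N1) mcp supI h0 ac c0 (ltW r0).
rewrite sub0r powR_div ?(ltW rc0) ?(ltW nc0) // mulrA ler_pdivlMr // in hr.
have q0 : 0 <= r * - c / (r - c) by rewrite divr_ge0 ?mulr_ge0 ?ltW.
have powE : (r * - c / (r - c)) `^ (N - 1) <= h 0 / (N * theta).
  rewrite powR_div ?mulr_ge0 ?(ltW r0) ?(ltW nc0) ?(ltW rc0) //.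
  rewrite powRM ?(ltW r0) ?(ltW nc0) //.
  rewrite ler_pdivrMr // mulrAC ler_pdivlMr ?mulr_gt0 //.
  apply: le_trans hr; rewrite mulrC mulrA ler_pM2r //.
  by rewrite /density_ratio ler_pdivlMr ?mulr_gt0 // in th_le; lra.
have -> : r * - c / (r - c)
    = ((r * - c / (r - c)) `^ (N - 1)) `^ (1 / (N - 1)).
  by rewrite -powRrM mul1r divff ?gt_eqF // powRr1.
apply: ge0_ler_powR powE; rewrite ?nnegrE ?powR_ge0 ?divr_ge0 ?(ltW p0) //.
  by rewrite ltW.
by rewrite mulr_ge0 ?ltW.
Qed.

Theorem lemma3p2 (R : realType) (N : R) (I : set R) (h : R -> R)
    (hN : 1 < N)
    (hI : open_interval I)
    (hcont : {within I, continuous h})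
    (hpos : forall x, I x -> 0 < h x)
    (hMCP : MCP0 N I h)
    (hI0 : I 0)
    (hsup : esup I = +oo%E) :
  [/\ {in `]0, +oo[ &, {homo density_ratio N h : r s /~ r <= s}},
      cvg (density_ratio N h r @[r --> +oo])
    & let theta := lim (density_ratio N h r @[r --> +oo]) in
      I `<=` [set x : R | (left_bound N (h 0%R) theta < x%:E < +oo)%E]].
Proof.
case: hI => I_open I_itv _.
have N1 : 1 <= N by exact: ltW.
have N0 : 0 < N by exact: lt_trans hN.
have h_gt0 r : 0 < r -> 0 < h r.
  by move=> r0; apply: hpos; apply: esup_pinfty_mem hI0 (ltW r0).
have f_ni := density_ratio_nonincreasing N1 hMCP hsup (einf_le hI0) h_gt0.
have f_ge0 r : 0 < r -> 0 <= density_ratio N h r.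
  by move=> r0; rewrite divr_ge0 ?mulr_ge0 ?powR_ge0 ?ltW ?h_gt0.
have f_cvg := nonincreasing_cvgr_pinfty f_ni f_ge0.
split => // theta x Ix /=; rewrite ltry andbT /left_bound.
have th_ge0 : 0 <= theta.
  apply: limr_ge => //; near=> r; apply: f_ge0; near: r.
  exact: nbhs_pinfty_gt (num_real _).
case: ifPn => [_|th_neq0]; first exact: ltNyr.
have th_gt0 : 0 < theta by rewrite lt_neqAle eq_sym th_neq0.
rewrite lte_fin; have [x_ge0|x_lt0] := leP 0 x.
  apply: lt_le_trans x_ge0.
  by rewrite oppr_lt0 powR_gt0 // divr_gt0 ?mulr_gt0 ?hpos.
have [y yx Iy] := open_lt_mem I_open Ix.
have y_lt0 : y < 0 by exact: lt_trans yx x_lt0.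
(* r (- y) / (r - y) > - x amounts to r (x - y) > x y. *)
pose r := (x * y + 1) / (x - y).
have xy0 : 0 < x * y by rewrite nmulr_rgt0.
have r0 : 0 < r by rewrite divr_gt0 ?subr_gt0 ?addr_gt0.
have rE : r * (x - y) = x * y + 1 by rewrite divfK // subr_eq0 gt_eqF.
have th_le := nonincreasing_lim_pinfty_le f_ni f_cvg r0.
have h0 : 0 < h 0 by exact: hpos.
have := MCP0_vertex_le hN hMCP hsup h0 (einf_le Iy) y_lt0 r0 th_gt0 th_le.
rewrite ltrNl; apply: lt_le_trans.
by rewrite ltr_pdivlMr; lra.
Unshelve. all: by end_near. Qed.
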